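(* Let $\sigma_1,\sigma_2$ be finite positive Borel measures with support contained in the unit circle $\mathbb{T}$. Assume that at least one of them verifies the Szegő condition. Then the measure $\sigma:=\sigma_1+\sigma_2$ verifies the Szegő condition. In particular, if $d\widetilde{\sigma}=d\sigma+r\,\frac{d\theta}{2\pi}$ with $r>0$ for some finite positive Borel measure $\sigma$ with support in $\mathbb{T}$, then $\widetilde{\sigma}$ verifies the Szegő condition.
   Context: $\frac{d\theta}{2\pi}$ is normalized Lebesgue measure on the unit circle $\mathbb{T}=\{z\in\mathbb{C}:|z|=1\}$. A finite positive Borel measure $\sigma$ on $\mathbb{T}$, with Lebesgue decomposition $d\sigma=w(\theta)\frac{d\theta}{2\pi}+d\sigma_s$ ($\sigma_s$ singular with respect to Lebesgue measure), verifies the Szegő condition if $\int_{0}^{2\pi}\log w(\theta)\,\frac{d\theta}{2\pi}>-\infty$. The measures $\sigma_1,\sigma_2,\sigma$ are not required to have infinite support a priori. *)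

(* Defs.v *)
From HB Require Import structures.
From mathcomp Require Import all_boot all_order all_algebra.
From mathcomp Require Import complex.
From mathcomp Require Import all_classical all_reals all_analysis.

Set Implicit Arguments.
Unset Strict Implicit.
Unset Printing Implicit Defensive.

Import Order.TTheory GRing.Theory Num.Theory.
Import numFieldNormedType.Exports.

Local Open Scope classical_set_scope.
Local Open Scope ring_scope.

(** The complex plane with its Borel sigma-algebra, generated by the open sets
    of [R[i]^o], that is, of [R[i]] with the topology of the modulus. *)
Definition borelC (R : realType) := g_sigma_algebraType (@open R[i]^o).

Definition unit_circle (R : realType) : set (borelC R) :=
  [set z | `|z : R[i]| = 1].
Arguments unit_circle R : clear implicits.

(** The parametrization [t |-> e^(it)] of the unit circle. *)
Definition expi {R : realType} (t : R) : borelC R := Complex (cos t) (sin t).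

Lemma continuous_expi (R : realType) : continuous (expi : R -> R[i]^o).
Proof.
move=> x; apply/(@cvgrPdist_le _ R[i]^o) => -[e b].
rewrite ltcE /= => /andP[/eqP -> er].
have e20 : 0 < e / 2 by rewrite divr_gt0.
have /cvgrPdist_le/(_ _ e20) hc := @continuous_cos R x.
have /cvgrPdist_le/(_ _ e20) hs := @continuous_sin R x.
near=> t.
have ct : `|cos x - cos t| <= e / 2 by near: t; exact: hc.
have st : `|sin x - sin t| <= e / 2 by near: t; exact: hs.
rewrite normc_def lecR /=.
apply: (@le_trans _ _ (`|cos x - cos t| + `|sin x - sin t|)); last first.
  by rewrite [leRHS]splitr lerD.
rewrite -[leRHS]ger0_norm ?addr_ge0// -sqrtr_sqr ler_wsqrtr//.
rewrite -(real_normK (num_real (cos x - cos t))).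
rewrite -(real_normK (num_real (sin x - sin t))).
by rewrite sqrrD lerD2r lerDl mulrn_wge0// mulr_ge0.
Unshelve. all: by end_near. Qed.

Lemma measurable_expi (R : realType) :
  measurable_fun [set: measurableTypeR R] (@expi R).
Proof.
apply: (@measurability _ _ (measurableTypeR R) (borelC R) _ _ (@open R[i]^o)) => //.
move=> _ [U oU <-]; rewrite setTI.
apply: measurable_realfun.open_measurable.
by apply: open_comp => // x _; exact: continuous_expi.
Qed.

Lemma inv_2pi_ge0 (R : realType) : 0 <= (2 * pi)^-1 :> R.
Proof. by rewrite invr_ge0 mulr_ge0// pi_ge0. Qed.

(** The measure [dt / 2pi] on the line of angles. *)
Definition angle_measure (R : realType) :
    {measure set (measurableTypeR R) -> \bar R} :=
  mscale (NngNum (inv_2pi_ge0 R)) lebesgue_measure.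
Arguments angle_measure R : clear implicits.

(** Normalized Lebesgue measure on the unit circle, as a measure on the plane:
    the image under [expi] of [dt / 2pi] on [[0, 2pi]]. *)
Definition circle_lebesgue (R : realType) : set (borelC R) -> \bar R :=
  pushforward
    (mrestr (angle_measure R) (@measurable_itv R `[0, 2 * pi])) (@expi R).
Arguments circle_lebesgue R : clear implicits.

Section circle_lebesgue_measure.
Variable R : realType.
Local Open Scope ereal_scope.

Let circle_lebesgue0 : circle_lebesgue R set0 = 0.
Proof. by apply: measure0; exact: measurable_expi. Qed.

Let circle_lebesgue_ge0 A : 0 <= circle_lebesgue R A.
Proof. by apply: measure_ge0; exact: measurable_expi. Qed.

Let circle_lebesgue_sigma_additive : semi_sigma_additive (circle_lebesgue R).
Proof. by apply: measure_semi_sigma_additive; exact: measurable_expi. Qed.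

HB.instance Definition _ := isMeasure.Build _ _ _ (circle_lebesgue R)
  circle_lebesgue0 circle_lebesgue_ge0 circle_lebesgue_sigma_additive.

End circle_lebesgue_measure.

(** The closed support: the points all of whose open neighbourhoods are
    charged. *)
Definition msupport (R : realType) (mu : set (borelC R) -> \bar R) :
    set (borelC R) :=
  [set z | forall U : set R[i]^o, open U -> U z -> (0 < mu U)%E].

Definition mutually_singular d (T : measurableType d) (R : realType)
    (mu nu : set T -> \bar R) : Prop :=
  exists N : set T, [/\ measurable N, mu N = 0%E & nu (~` N) = 0%E].

(** [sigma = w(t) dt/2pi + sigma_s], the density being a function of the
    angle [t] in [[0, 2pi]]. *)
Definition lebesgue_decomposition (R : realType)
    (sigma : set (borelC R) -> \bar R) (w : R -> R)
    (sigma_s : {measure set (borelC R) -> \bar R}) : Prop :=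
  [/\ forall t, t \in `[0, 2 * pi] -> 0 <= w t,
      (angle_measure R).-integrable `[0, 2 * pi] (EFin \o w),
      mutually_singular (circle_lebesgue R) sigma_s &
      forall A : set (borelC R), measurable A ->
        sigma A = (\int[angle_measure R]_(t in `[0%R, (2 * pi)%R] `&`
                     (expi @^-1` A)) (w t)%:E + sigma_s A)%E].

(** The logarithm is the extended one, [lne 0 = -oo] (whereas [ln 0 = 0]).
    The integral makes sense in [[-oo, +oo[], the positive part of [log w]
    being dominated by the integrable density [w]. The density is unique up to
    a null set, so the choice of decomposition is immaterial. *)
Definition szego (R : realType) (sigma : set (borelC R) -> \bar R) : Prop :=
  exists (w : R -> R) (sigma_s : {measure set (borelC R) -> \bar R}),
    lebesgue_decomposition sigma w sigma_s /\
    (-oo < \int[angle_measure R]_(t in `[0%R, (2 * pi)%R]) lne (w t)%:E)%E.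

(* Main.v *)
Require Import Defs.
From HB Require Import structures.
From mathcomp Require Import all_boot all_order all_algebra.
From mathcomp Require Import complex.
From mathcomp Require Import all_classical all_reals all_analysis.
From mathcomp Require Import measurable_realfun.

Import Order.TTheory GRing.Theory Num.Theory.
Import numFieldNormedType.Exports.

Local Open Scope classical_set_scope.
Local Open Scope ring_scope.

(** The density of a sum is the sum of the densities. If [sigma1] has density
    [w1] with [log w1] of integral [> -oo], and [sigma2] has density
    [w2 >= 0], then [log (w1 + w2) >= log w1] pointwise, so that the integral
    of [log (w1 + w2)] is [> -oo] as well ([ltNye_le_integral]).

    What gives this one-line argument its substance is that the Szegő condition
    speaks of the Lebesgue decomposition: the other measure [sigma2] does not
    come with one, and must first be given it
    ([lebesgue_decomposition_exists]). It is derived from the Radon-Nikodym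
    theorem, used twice: once to find a Lebesgue-null set [N] that carries the
    whole singular part ([ex_null_set_carrying_singular_part]), once to get a
    density for the restriction of [sigma2] to the complement of [N]. The
    density so obtained lives on the plane; composing it with [t |-> e^(it)]
    turns it into a function of the angle ([ge0_integral_circle_lebesgue]).
    Then decompositions add up ([lebesgue_decomposition_add]): singularity is
    preserved because the union of two null sets is null.

    The second assertion is the instance of the first in which the measure
    known to satisfy the condition is [r dt/2pi], of constant density [r]:
    its logarithmic integral is [ln r]. *)

(** * Lebesgue decomposition of finite measures *)

Lemma measure_add_fin_num_fun d (T : measurableType d) (R : realType)
    (m1 m2 : {finite_measure set T -> \bar R}) :
  fin_num_fun (measure_add m1 m2).
Proof.
by move=> A mA; rewrite measure_addE fin_numD !fin_num_measure.
Qed.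

Section finite_measure_add.
Context d (T : measurableType d) (R : realType).
Variables m1 m2 : {finite_measure set T -> \bar R}.

HB.instance Definition _ := Measure.on (measure_add m1 m2).
HB.instance Definition _ := Measure_isFinite.Build d T R (measure_add m1 m2)
  (@measure_add_fin_num_fun d T R m1 m2).

End finite_measure_add.

(** Both measures are absolutely continuous with respect to [nu = lam + sigma];
    let [f >= 0] be the density of [lam] with respect to [nu]. The set [N] where
    [f] vanishes is [lam]-null since [lam N] is the integral of [f] over [N].
    Off [N] the density is positive, so a [lam]-null set disjoint from [N] is
    [nu]-null, hence [sigma]-null. *)
Lemma ex_null_set_carrying_singular_part d (T : measurableType d) (R : realType)
    (lam sigma : {finite_measure set T -> \bar R}) :
  exists N : set T, [/\ measurable N, lam N = 0%E &
    forall A, measurable A -> lam A = 0%E -> sigma (A `\` N) = 0%E].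
Proof.
pose nu : {finite_measure set T -> \bar R} := measure_add lam sigma.
have lam_nu : lam `<< nu.
  apply/null_content_dominatesP => A mA; rewrite /nu/= measure_addE => /eqP.
  by rewrite padde_eq0 ?measure_ge0// => /andP[/eqP].
have [f [f0 ffin /integrableP[mf _] lamE]] := radon_nikodym_sigma_finite lam_nu.
pose N := [set x | (f x <= 0)%E].
have mN : measurable N.
  by rewrite -[N]setTI; apply: emeasurable_fun_infty_c.
exists N; split => //.
  rewrite lamE// integral0_eq// => x /= fx; apply/eqP.
  by rewrite eq_le fx f0.
move=> A mA lamA; have mAN : measurable (A `\` N) by exact: measurableD.
have lamAN : lam (A `\` N) = 0%E by apply: subset_measure0 lamA.
have mfAN : measurable_fun (A `\` N) f by apply: measurable_funTS.
have : (\int[nu]_(x in A `\` N) `|f x| = 0)%E.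
  by rewrite -lamAN lamE//; apply: eq_integral => x _; rewrite gee0_abs.
move=> /(ae_eq_integral_abs nu mAN mfAN)[Z [mZ nuZ ZE]].
have : nu (A `\` N) = 0%E.
  apply: subset_measure0 nuZ => // x ANx; apply: ZE => /= /(_ ANx) fx.
  by apply: ANx.2; rewrite /N/= fx.
rewrite /nu/= measure_addE => /eqP.
by rewrite padde_eq0 ?measure_ge0// => /andP[_ /eqP].
Qed.

(** The singular part is [sigma] restricted to the [lam]-null set [N] of the
    previous lemma; the restriction of [sigma] to the complement of [N] is
    dominated by [lam], and [f] is its Radon-Nikodym derivative. *)
Lemma lebesgue_decomposition_exists d (T : measurableType d) (R : realType)
    (lam sigma : {finite_measure set T -> \bar R}) :
  exists (f : T -> R) (sigma_s : {measure set T -> \bar R}),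
    [/\ forall x, 0 <= f x, lam.-integrable setT (EFin \o f),
        mutually_singular lam sigma_s &
        forall A, measurable A ->
          sigma A = (\int[lam]_(x in A) (f x)%:E + sigma_s A)%E].
Proof.
have [N [mN lamN lamP]] := @ex_null_set_carrying_singular_part d T R lam sigma.
have mCN : measurable (~` N) by exact: measurableC.
pose sigma_c : {finite_measure set T -> \bar R} := mrestr sigma mCN.
have dom : sigma_c `<< lam.
  by apply/null_content_dominatesP => A mA lamA; exact: lamP.
have [f [f0 ffin intf sigmaE]] := radon_nikodym_sigma_finite dom.
have fE : EFin \o (fine \o f) = f by apply/funext => x /=; rewrite fineK.
exists (fine \o f), (mrestr sigma mN); split.
- by move=> x; rewrite fine_ge0.
- by rewrite fE.
- by exists N; split => //=; rewrite /mrestr setICl measure0.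
move=> A mA; rewrite [X in (X + _)%E](_ : _ = sigma_c A); last first.
  by rewrite sigmaE//; apply: eq_integral => x _ /=; rewrite fineK.
by rewrite /sigma_c/= /mrestr -setDE -measureDI.
Qed.

Lemma ge0_integral_mrestr d (T : measurableType d) (R : realType)
    (mu : {measure set T -> \bar R}) (D A : set T) (mD : measurable D)
    (f : T -> \bar R) : measurable A -> measurable_fun A f ->
    (forall x, A x -> 0 <= f x)%E ->
  (\int[mrestr mu mD]_(x in A) f x = \int[mu]_(x in D `&` A) f x)%E.
Proof.
move=> mA mf f0.
have mDA : measurable (D `&` A) by exact: measurableI.
have mAD : measurable (A `\` D) by exact: measurableD.
have AE : A = (D `&` A) `|` (A `\` D) by rewrite (setIC D) setUIDK.
rewrite {1}AE ge0_integral_setU//; last 3 first.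
- by rewrite -AE.
- by rewrite -AE.
- by apply/disj_setPS => x [[Dx _] [_ /(_ Dx)]].
rewrite [X in (_ + X)%E]null_set_integral//; last 2 first.
- by apply: measurable_funS mf => //; exact: subDsetl.
- by rewrite /= /mrestr setDKI measure0.
rewrite adde0; apply: eq_measure_integral => B mB BDA /=.
by rewrite /mrestr setIidl// => x /BDA[].
Qed.

(** * Normalized Lebesgue measure on the circle *)

Section circle.
Variable R : realType.
Local Open Scope ereal_scope.

Let D : set R := `[0%R, (2 * pi)%R].

Lemma measurable_preimage_expi (A : set (borelC R)) : measurable A ->
  measurable ((@expi R) @^-1` A : set (measurableTypeR R)).
Proof.
by move=> mA; rewrite -[X in measurable X]setTI; exact: measurable_expi.
Qed.

Lemma angle_measure_circle : angle_measure R D = 1.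
Proof.
rewrite /D /angle_measure/= /mscale/= lebesgue_measure_itv/= lte_fin.
rewrite mulr_gt0 ?pi_gt0//.
by rewrite oppr0 adde0 -EFinM mulVf// gt_eqF// mulr_gt0// pi_gt0.
Qed.

Lemma circle_lebesgue_fin_num_fun : fin_num_fun (circle_lebesgue R).
Proof.
move=> A mA; rewrite ge0_fin_numE ?measure_ge0//.
rewrite (@le_lt_trans _ _ 1)// ?ltry//.
rewrite -angle_measure_circle /circle_lebesgue /pushforward /mrestr.
rewrite le_measure ?inE//; last exact: measurable_itv.
apply: measurableI; last exact: measurable_itv.
exact: measurable_preimage_expi.
Qed.

HB.instance Definition _ := Measure_isFinite.Build _ _ R (circle_lebesgue R)
  circle_lebesgue_fin_num_fun.

(** Change of variables [z = e^(it)], which turns a density on the plane into a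
    density in the angle. *)
Lemma ge0_integral_circle_lebesgue (A : set (borelC R)) (f : borelC R -> R) :
  measurable A -> measurable_fun setT f -> (forall z, 0 <= f z)%R ->
  \int[circle_lebesgue R]_(z in A) (f z)%:E =
  \int[angle_measure R]_(t in D `&` expi @^-1` A) (f (expi t))%:E.
Proof.
move=> mA mf f0.
have mEf : measurable_fun setT (EFin \o f) by exact/measurable_EFinP.
have mE := @measurable_expi R.
rewrite (@ge0_integral_pushforward _ _ _ _ _ _ mE)//=; last 2 first.
- by apply: measurable_funTS.
- by move=> z _; rewrite lee_fin.
rewrite ge0_integral_mrestr//.
- exact: measurable_preimage_expi.
- by apply: measurable_funTS; exact: (measurableT_comp mEf mE).
- by move=> t _; rewrite lee_fin.
Qed.

Lemma lebesgue_decomposition_finite_measure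
    (sigma : {finite_measure set (borelC R) -> \bar R}) :
  exists (w : R -> R) (sigma_s : {measure set (borelC R) -> \bar R}),
    lebesgue_decomposition sigma w sigma_s.
Proof.
have [f [s [f0 intf sing sigmaE]]] :=
  @lebesgue_decomposition_exists _ _ R (circle_lebesgue R) sigma.
have mf : measurable_fun setT f.
  by apply/measurable_EFinP; case/integrableP : intf.
have mfe : measurable_fun setT (f \o expi).
  exact: (measurableT_comp mf (@measurable_expi R)).
exists (f \o expi), s; split => //.
- by move=> t _; exact: f0.
- apply/integrableP; split.
    by apply: measurable_funTS; exact/measurable_EFinP.
  case/integrableP : intf => _; apply: le_lt_trans.
  rewrite [leRHS](eq_integral (EFin \o f)); last first.
    by move=> z _ /=; rewrite ger0_norm.
  rewrite ge0_integral_circle_lebesgue// preimage_setT setIT.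
  by rewrite le_eqVlt; apply/orP; left; apply/eqP; apply: eq_integral => t _ /=;
     rewrite ger0_norm.
- by move=> A mA; rewrite sigmaE// ge0_integral_circle_lebesgue.
Qed.

End circle.

(** * Monotonicity of the logarithmic integral *)

Lemma measurable_lne (R : realType) : measurable_fun setT (@lne R \o EFin).
Proof.
apply: (eq_measurable_fun
  (fun r : R => if (r <= 0)%R then -oo%E else (ln r)%:E)) => //.
apply: measurable_fun_ifT => //.
  exact: measurable_fun_ler.
by apply/measurable_EFinP.
Qed.

(** Only the integral of the negative part matters: it decreases when the
    function grows, and with the convention [+oo - oo = -oo] an integral is
    [> -oo] exactly when that of its negative part is finite. *)
Lemma ltNye_le_integral d (T : measurableType d) (R : realType)
    (mu : {measure set T -> \bar R}) (D : set T) (mD : measurable D)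
    (f g : T -> \bar R) :
  measurable_fun D f -> measurable_fun D g ->
  (forall x, D x -> f x <= g x)%E ->
  (-oo < \int[mu]_(x in D) f x)%E -> (-oo < \int[mu]_(x in D) g x)%E.
Proof.
move=> mf mg fg; rewrite integralE [in X in _ -> X]integralE => intf.
have negf : (\int[mu]_(x in D) f^\- x < +oo)%E.
  by rewrite ltey; apply: contraTneq intf => ->; rewrite addeNy ltxx.
have negg : (\int[mu]_(x in D) g^\- x < +oo)%E.
  apply: le_lt_trans negf; apply: ge0_le_integral => //.
  - exact: measurable_funeneg.
  - exact: measurable_funeneg.
  - by move=> x Dx; apply: (@funeneg_le _ _ D); rewrite ?inE// => y /set_mem/fg.
have posg : (0 <= \int[mu]_(x in D) g^\+ x)%E by exact: integral_ge0.
apply: (@lt_le_trans _ _ (- \int[mu]_(x in D) g^\- x)%E).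
  by rewrite ltNye_eq fin_numN ge0_fin_numE ?negg//; exact: integral_ge0.
by rewrite leeDr.
Qed.

(** * Stability of the Szegő condition under sums *)

Lemma mutually_singular_add d (T : measurableType d) (R : realType)
    (lam s1 s2 : {measure set T -> \bar R}) :
  mutually_singular lam s1 -> mutually_singular lam s2 ->
  mutually_singular lam (measure_add s1 s2).
Proof.
move=> [N1 [mN1 lamN1 s1N1]] [N2 [mN2 lamN2 s2N2]].
exists (N1 `|` N2); split; first exact: measurableU.
  by rewrite measureU0.
rewrite measure_addE setCU.
have mC1 : measurable (~` N1) by exact: measurableC.
have mC2 : measurable (~` N2) by exact: measurableC.
have mC : measurable (~` N1 `&` ~` N2) by exact: measurableI.
rewrite [X in (X + _)%E](@subset_measure0 _ _ _ s1 _ (~` N1))//.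
by rewrite [X in (_ + X)%E](@subset_measure0 _ _ _ s2 _ (~` N2))// adde0.
Qed.

Lemma lebesgue_decomposition_add (R : realType)
    (sigma1 sigma2 s1 s2 : {measure set (borelC R) -> \bar R})
    (w1 w2 : R -> R) :
  lebesgue_decomposition sigma1 w1 s1 -> lebesgue_decomposition sigma2 w2 s2 ->
  lebesgue_decomposition (measure_add sigma1 sigma2) (w1 \+ w2)
    (measure_add s1 s2).
Proof.
move=> [w10 intw1 sing1 E1] [w20 intw2 sing2 E2]; split.
- by move=> t Dt; rewrite addr_ge0 ?w10 ?w20.
- rewrite (_ : EFin \o _ = (EFin \o w1) \+ (EFin \o w2))//.
  exact: integrableD.
- exact: mutually_singular_add.
move=> A mA; rewrite /= !measure_addE E1// E2// addeACA.
congr (_ + _)%E; last exact/esym/measure_addE.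
have mDA : measurable (`[0%R, (2 * pi)%R] `&` (@expi R) @^-1` A).
  apply: measurableI; first exact: measurable_itv.
  exact: measurable_preimage_expi.
have sub : `[0%R, (2 * pi)%R] `&` (@expi R) @^-1` A `<=` `[0%R, (2 * pi)%R].
  exact: subIsetl.
rewrite -ge0_integralD//.
- by move=> t [/= Dt _]; rewrite lee_fin w10.
- by apply: measurable_funS sub _ => //; case/integrableP : intw1.
- by move=> t [/= Dt _]; rewrite lee_fin w20.
- by apply: measurable_funS sub _ => //; case/integrableP : intw2.
Qed.

(** Any Lebesgue decomposition of [sigma2] does: its density [w2] is
    nonnegative, so [lne w1 <= lne (w1 + w2)] on the whole interval, points
    where [w1] vanishes included since [lne 0 = -oo]. *)
Lemma szego_addl (R : realType) (sigma1 : {measure set (borelC R) -> \bar R})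
    (sigma2 : {finite_measure set (borelC R) -> \bar R}) :
  szego sigma1 -> szego (measure_add sigma1 sigma2).
Proof.
move=> [w1 [s1 [dec1 log1]]].
have [w2 [s2 dec2]] := lebesgue_decomposition_finite_measure _ sigma2.
have dec := lebesgue_decomposition_add _ _ _ _ _ _ _ dec1 dec2.
exists (w1 \+ w2), (measure_add s1 s2); split=> //.
have mlog sigma w s : lebesgue_decomposition sigma w s ->
    measurable_fun (`[0%R, (2 * pi)%R] : set R) (fun t => lne (w t)%:E).
  move=> [_ /integrableP[/measurable_EFinP mw _] _ _].
  exact: (measurableT_comp (measurable_lne R) mw).
apply: ltNye_le_integral log1 => //.
- exact: mlog dec1.
- exact: mlog dec.
case: dec1 dec2 => w10 _ _ _ [w20 _ _ _] t Dt.
have p1 := w10 t Dt; have p2 := w20 t Dt.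
have itv0y x : 0 <= x -> x%:E \in `[0%E, +oo%E : \bar R].
  by move=> x0; rewrite in_itv/= lee_fin x0 leey.
by rewrite lee_lne ?itv0y ?addr_ge0// lee_fin lerDl.
Qed.

Lemma szego_addr (R : realType)
    (sigma1 : {finite_measure set (borelC R) -> \bar R})
    (sigma2 : {measure set (borelC R) -> \bar R}) :
  szego sigma2 -> szego (measure_add sigma1 sigma2).
Proof.
move=> /(szego_addl _ _ sigma1); congr szego.
by apply/funext => A; rewrite !measure_addE addeC.
Qed.

Lemma szego_scale_circle_lebesgue (R : realType) (r : {nonneg R}) :
  0 < r%:num -> szego (mscale r (circle_lebesgue R)).
Proof.
move=> r0.
have mD : measurable (`[0%R, (2 * pi)%R] : set (measurableTypeR R)).
  exact: measurable_itv.
exists (cst r%:num), mzero; split; last first.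
  rewrite (_ : (fun _ => _) = cst (ln r%:num)%:E); last first.
    by apply/funext => t; rewrite lne_EFin.
  rewrite integral_cst//.
  by rewrite angle_measure_circle mule1 ltNyr.
split=> //.
- apply/integrableP; split; first exact/measurable_EFinP/measurable_cst.
  rewrite /= integral_cst//= angle_measure_circle mule1.
  exact: ltry.
- by exists set0; split => //; rewrite measure0.
move=> A mA; rewrite /= /mzero adde0 integral_cst//=; last first.
  by apply: measurableI => //; exact: measurable_preimage_expi.
by rewrite /mscale /= /circle_lebesgue /pushforward /mrestr setIC.
Qed.

Theorem corollary1 (R : realType) :
  (forall sigma1 sigma2 : {finite_measure set (borelC R) -> \bar R},
     msupport sigma1 `<=` unit_circle R ->
     msupport sigma2 `<=` unit_circle R ->
     szego sigma1 \/ szego sigma2 ->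
     szego (measure_add sigma1 sigma2)) /\
  (forall (sigma : {finite_measure set (borelC R) -> \bar R}) (r : R)
          (hr : 0 < r),
     msupport sigma `<=` unit_circle R ->
     szego (measure_add sigma (mscale (NngNum (ltW hr)) (circle_lebesgue R)))).
Proof.
split.
  by move=> sigma1 sigma2 _ _ [/szego_addl|/szego_addr]; exact.
by move=> sigma r hr _; apply: szego_addr; exact: szego_scale_circle_lebesgue.
Qed.
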